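(* For $i\in\mathbb{N}$ let $b_i=(\mathrm{id},T,\mathrm{id},\dots,T^i)$ be the alternating sequence with $i+1$ entries in $\mathbb{S}_2=\{\mathrm{id},T\}$, a degree $i$ element of the arity $2$ part of the Barratt–Eccles operad. The table reduction morphism sends $b_i$ to the alternating surjection $(1,2,1,2,\dots)$ with $i+2$ entries, and the action of $b_i$ on simplicial chains is $\triangle^{\mathrm S}_i$; that is, the alternating sequences define Steenrod's cup-$i$ construction.
   Context: All chains are over $\mathbb{F}_2$. $N(\Delta^n)$ has basis the faces $[v_0,\dots,v_m]$, $v_0<\dots<v_m$, of the standard $n$-simplex; $[n]$ is its top-dimensional face. **Surjections and their action.** $\triangle_{\mathrm{AW}}[v_0,\dots,v_m]=\sum_{j}[v_0,\dots,v_j]\otimes[v_j,\dots,v_m]$ is the Alexander–Whitney diagonal; the join $\ast\colon N(\Delta^n)^{\otimes 2}\to N(\Delta^n)$ sends a tensor of two faces to the face spanned by the union of their vertex sets if these are disjoint, and to $0$ otherwise. Set $\triangle_{\mathrm{AW}}^{[1]}=\mathrm{id}$, $\triangle_{\mathrm{AW}}^{[m+1]}=(\triangle_{\mathrm{AW}}^{[m]}\otimes\mathrm{id})\circ\triangle_{\mathrm{AW}}$, $\ast^{[1]}=\mathrm{id}$, $\ast^{[m+1]}=\ast\circ(\ast^{[m]}\otimes\mathrm{id})$. A surjection $s\colon\{1,\dots,\ell\}\to\{1,2\}$ is written $(s(1),\dots,s(\ell))$, has degree $\ell-2$, and represents $0$ if it has two equal consecutive entries. A nondegenerate $s$ acts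 by $(\ast^{[|s^{-1}(1)|]}\otimes\ast^{[|s^{-1}(2)|]})\circ\pi_s\circ\triangle_{\mathrm{AW}}^{[\ell]}$, where $\pi_s$ groups the tensor factors according to the fibers of $s$, preserving order within each fiber. **Barratt–Eccles operad in arity $2$.** It is $N(E\mathbb{S}_2)$: its degree $d$ part is spanned by sequences $(w_0,\dots,w_d)$ in $\mathbb{S}_2$, modulo those with two equal consecutive entries. Write $\mathrm{id}$ as the list $1,2$ and $T$ as the list $2,1$. The table reduction morphism $\mathrm{TR}$ of Berger–Fresse to the surjection operad is, in arity $2$, $\mathrm{TR}(w_0,\dots,w_d)=\sum s_{(r_0,\dots,r_d)}$, the sum over positive integers with $r_0+\dots+r_d=d+2$; here $s_{(r_0,\dots,r_d)}$ is the concatenation of rows $0,\dots,d$, where row $k$ consists of the first $r_k$ entries of the list $w_k$ after deleting every value that has occurred in an earlier row at a position other than the last position of that row. An element of the Barratt–Eccles operad acts on simplicial chains via its image under $\mathrm{TR}$. **Steenrod's construction.** $\triangle^{\mathrm S}_i\colon N(\Delta^n)\to N(\Delta^n)^{\otimes2}$ is the family of maps, natural with respect to coface maps, determined as follows. If $i>n$ then $\triangle^{\mathrm S}_i[n]=0$; otherwise $\triangle_i^{\mathrm S}[n]$ is the sum over all integers $0\le p_1<\dots<p_{i+1}\le n$ of $$[0,\dots,p_1]\ast[p_2,\dots,p_3]\ast\dots\ast[p_{i+1},\dots,n]\ \otimes\ [p_1,\dots,p_2]\ast\dots\ast[p_i,\dots,p_{i+1}]$$ if $i$ is odd, and of $$[0,\dots,p_1]\ast[p_2,\dots,p_3]\ast\dots\ast[p_i,\dots,p_{i+1}]\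 \otimes\ [p_1,\dots,p_2]\ast[p_3,\dots,p_4]\ast\dots\ast[p_{i+1},\dots,n]$$ if $i$ is even, where $[a,\dots,b]$ denotes the face on all integers from $a$ to $b$. *)

(* Defs.v *)
From HB Require Import structures.
From mathcomp Require Import all_boot all_order all_fingroup all_algebra.
Set Implicit Arguments.
Unset Strict Implicit.
Unset Printing Implicit Defensive.

Import GRing.Theory.
Local Open Scope ring_scope.

(* Free F_2-modules on finite sets. The tensor product of the free modules on *)
(* I and J is the free module on I * J, and the m-th tensor power of the free *)
(* module on I is the free module on m.-tuple I.                              *)

Notation F2free I := {ffun I -> ('F_2)^o}.

HB.lock Definition bas (I : finType) (x : I) : F2free I := [ffun y => (y == x)%:R].

Canonical bas_unlockable := Unlockable bas.unlock.

Lemma basE (I : finType) (x y : I) : bas x y = (y == x)%:R.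
Proof. by rewrite unlock ffunE. Qed.

Definition linext (I : finType) (V : lmodType 'F_2) (f : I -> V)
  (c : F2free I) : V := \sum_x c x *: f x.

Definition tens (I J : finType) (a : F2free I) (b : F2free J) :
  F2free (I * J) := [ffun p => (a p.1 : 'F_2) * (b p.2 : 'F_2)].

Definition tmap (I I' J J' : finType) (f : F2free I -> F2free I')
  (g : F2free J -> F2free J') : F2free (I * J) -> F2free (I' * J') :=
  linext (fun p => tens (f (bas p.1)) (g (bas p.2))).

(* Normalized chains of the standard n-simplex, in all degrees at once: the   *)
(* free module on the nonempty subsets of {0, ..., n}.                        *)

Definition face (n : nat) := {A : {set 'I_n.+1} | A != set0}.
HB.instance Definition _ (n : nat) := SubFinite.on (face n).
Definition chain (n : nat) := F2free (face n).
Definition chain2 (n : nat) := F2free (face n * face n).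

(* The basis element of a vertex set. The empty set would give 0, but does    *)
(* not occur in any of the formulas below.                                    *)
Definition fc (n : nat) (A : {set 'I_n.+1}) : chain n :=
  if insub A is Some F then bas F else 0.

(* The map induced by f on chains. It is only used for f injective: for other *)
(* f, faces on which f is not injective should be sent to 0.                  *)
Definition push (m n : nat) (f : 'I_m.+1 -> 'I_n.+1) : chain m -> chain n :=
  linext (fun F : face m => fc (f @: val F)).

Definition push2 (m n : nat) (f : 'I_m.+1 -> 'I_n.+1) : chain2 m -> chain2 n :=
  tmap (push f) (push f).

Definition AW (n : nat) : chain n -> chain2 n :=
  linext (fun F : face n => \sum_(j in val F)
    tens (fc [set v in val F | v <= j]%N) (fc [set v in val F | j <= v]%N)).

(* iterAW n m is the iterated diagonal with m.+1 tensor factors. *)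
Fixpoint iterAW (n m : nat) : chain n -> F2free (m.+1.-tuple (face n)) :=
  match m with
  | 0 => linext (fun F => bas [tuple F])
  | m'.+1 => fun c =>
      linext (fun p : m'.+1.-tuple (face n) * face n => bas (rcons_tuple p.1 p.2))
        (tmap (@iterAW n m') id (AW c))
  end.

Definition join (n : nat) : chain2 n -> chain n :=
  linext (fun p : face n * face n =>
    if [disjoint val p.1 & val p.2] then fc (val p.1 :|: val p.2) else 0).

(* The iterated join of c_1, ..., c_m, bracketed to the left; the case m = 0  *)
(* does not occur.                                                            *)
Definition joins (n : nat) (cs : seq (chain n)) : chain n :=
  if cs is c :: cs' then foldl (fun a b => join (tens a b)) c cs' else 0.

(* The element 1 is encoded as 0 : 'I_2 and 2 as 1 : 'I_2. *)

Definition nondeg (T : eqType) (s : seq T) : bool :=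
  sorted (fun x y => x != y) s.

Definition is_surj (d : nat) (s : d.+2.-tuple 'I_2) : bool :=
  nondeg s && [forall a, a \in s].

(* Degree d part of the arity 2 surjection operad: the quotient of a free     *)
(* module by the span of part of its basis is the free module on the rest.    *)
Definition Surj (d : nat) := F2free {s : d.+2.-tuple 'I_2 | is_surj s}.

(* The class of a sequence of length d + 2: the corresponding basis element,  *)
(* or 0 if the sequence is degenerate.                                        *)
Definition surj_class (d : nat) (s : seq 'I_2) : Surj d :=
  [ffun u => (tval (val u) == s)%:R].

Definition fiber_join (n : nat) (s : seq 'I_2) (a : 'I_2) (t : seq (face n)) :
  chain n := joins [seq bas F | F <- mask [seq x == a | x <- s] t].

Definition surj_act1 (d : nat) (s : d.+2.-tuple 'I_2) (n : nat) (c : chain n) :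
  chain2 n :=
  linext (fun t : d.+2.-tuple (face n) => tens (fiber_join s 0 t) (fiber_join s 1 t))
    (iterAW d.+1 c).

Definition surj_act (d : nat) (u : Surj d) (n : nat) (c : chain n) : chain2 n :=
  linext (fun s : {s : d.+2.-tuple 'I_2 | is_surj s} => surj_act1 (val s) c) u.

(* Degree d part of the arity 2 Barratt-Eccles operad. *)
Definition BE (d : nat) := F2free {w : d.+1.-tuple 'S_2 | nondeg w}.

(* The class of a sequence of length d + 1, or 0 if it is degenerate. *)
Definition be_class (d : nat) (w : seq 'S_2) : BE d :=
  [ffun u => (tval (val u) == w)%:R].

Definition perm_list (w : 'S_2) : seq 'I_2 := [seq w j | j <- enum 'I_2].

(* The concatenation of the rows; used lists the values that have occurred in *)
(* earlier rows at a position other than the last one.                        *)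
Fixpoint table_rows (used : seq 'I_2) (ws : seq 'S_2) (rs : seq nat) :
  seq 'I_2 :=
  match ws, rs with
  | w :: ws', r :: rs' =>
      let row := take r [seq x <- perm_list w | x \notin used] in
      row ++ table_rows (used ++ take (size row).-1 row) ws' rs'
  | _, _ => [::]
  end.

(* The entries r_k are positive with sum d + 2, hence at most d + 2; then     *)
(* the concatenated rows have length d + 2, by size_table_rows.               *)
Definition table_reduction1 (d : nat) (w : d.+1.-tuple 'S_2) : Surj d :=
  \sum_(r : d.+1.-tuple 'I_d.+3 |
      all (fun k : 'I_d.+3 => 0 < k)%N r && (sumn (map val r) == d.+2))
    surj_class d (table_rows [::] w (map val r)).

Definition table_reduction (d : nat) : BE d -> Surj d :=
  linext (fun w : {w : d.+1.-tuple 'S_2 | nondeg w} => table_reduction1 (val w)).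

Definition be_act (d : nat) (w : BE d) (n : nat) (c : chain n) : chain2 n :=
  surj_act (table_reduction w) c.

Definition T2 : 'S_2 := tperm 0 1.

Definition alt_be (i : nat) : BE i :=
  be_class i (mkseq (fun k => T2 ^+ k)%g i.+1).

Definition alt_surj (i : nat) : Surj i :=
  surj_class i (mkseq (fun k => if odd k then 1 else 0) i.+2).

(* The face [a, ..., b]. *)
Definition interval (n a b : nat) : chain n :=
  fc [set v : 'I_n.+1 | a <= v <= b]%N.

(* The blocks [0..p_1], [p_1..p_2], ..., [p_{i+1}..n] are numbered from 0; in *)
(* both parities of i the left factor joins those with even index and the     *)
(* right factor those with odd index.                                         *)
Definition steenrod_blocks (n : nat) (p : seq nat) : seq (chain n) :=
  pairmap (interval n) 0%N (rcons p n).

Definition steenrod_top (i n : nat) : chain2 n :=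
  if (n < i)%N then 0 else
  \sum_(p : i.+1.-tuple 'I_n.+1 | sorted ltn (map val p))
    let bs := steenrod_blocks n (map val p) in
    tens (joins [seq nth 0 bs k | k <- iota 0 (size bs) & ~~ odd k])
         (joins [seq nth 0 bs k | k <- iota 0 (size bs) & odd k]).

(* On a face [v_0, ..., v_m] the map is determined by its value on [m] and    *)
(* naturality with respect to k |-> v_k; see steenrodT and steenrod_push.     *)
Definition vertex (n : nat) (F : face n) (k : 'I_(#|val F|.-1).+1) : 'I_n.+1 :=
  nth ord0 (enum (val F)) k.

Definition steenrod (i n : nat) : chain n -> chain2 n :=
  linext (fun F : face n => push2 (@vertex n F) (steenrod_top i #|val F|.-1)).

Lemma linextU (I : finType) (V : lmodType 'F_2) (f : I -> V) x :
  linext f (bas x) = f x.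
Proof.
rewrite /linext (bigD1 x) //= basE eqxx scale1r big1 ?addr0 // => y ny.
by rewrite basE (negbTE ny) scale0r.
Qed.

Lemma linext_is_linear (I : finType) (V : lmodType 'F_2) (f : I -> V) :
  linear (linext f).
Proof.
move=> a u v; rewrite /linext scaler_sumr -big_split /=; apply: eq_bigr => x _.
by rewrite !ffunE scalerDl scalerA.
Qed.

HB.instance Definition _ (I : finType) (V : lmodType 'F_2) (f : I -> V) :=
  GRing.isLinear.Build 'F_2 (F2free I) V *:%R (linext f) (linext_is_linear f).

Lemma linext_comp (I J : finType) (V : lmodType 'F_2) (f : I -> F2free J)
    (g : J -> V) c :
  linext g (linext f c) = linext (fun x => linext g (f x)) c.
Proof.
rewrite {2}/linext linear_sum /= {2}/linext; apply: eq_bigr => x _.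
by rewrite linearZ.
Qed.

Lemma eq_linext (I : finType) (V : lmodType 'F_2) (f g : I -> V) :
  f =1 g -> linext f =1 linext g.
Proof. by move=> fg c; apply: eq_bigr => x _; rewrite fg. Qed.

Lemma linext_bas (I : finType) (c : F2free I) : linext (@bas I) c = c.
Proof.
apply/ffunP => y; rewrite /linext sum_ffunE (bigD1 y) //= big1 => [|x nx].
  by rewrite ffunE basE eqxx addr0 [_ *: _]mulr1.
by rewrite ffunE basE eq_sym (negbTE nx) scaler0.
Qed.

Lemma tmap_tens (I I' J J' : finType) (f : I -> F2free I') (g : J -> F2free J')
    a b :
  tmap (linext f) (linext g) (tens a b) = tens (linext f a) (linext g b).
Proof.
apply/ffunP => -[x y]; rewrite /tmap {1}/linext sum_ffunE.
transitivity (\sum_u \sum_v ((a u : 'F_2) * b v) * ((f u x : 'F_2) * g v y)).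
  rewrite pair_bigA /=; apply: eq_bigr => -[u v] _ /=.
  by rewrite !linextU !ffunE.
rewrite !ffunE /linext !sum_ffunE /= mulr_suml; apply: eq_bigr => u _.
by rewrite mulr_sumr; apply: eq_bigr => v _; rewrite !ffunE mulrACA.
Qed.

Lemma fcE (n : nat) (F : face n) : fc (val F) = bas F.
Proof. by rewrite /fc valK. Qed.

Lemma imset_face_neq0 (m n : nat) (f : 'I_m.+1 -> 'I_n.+1) (F : face m) :
  f @: val F != set0.
Proof. by rewrite imset_eq0; apply: valP F. Qed.

Definition face_im (m n : nat) (f : 'I_m.+1 -> 'I_n.+1) (F : face m) : face n :=
  exist _ (f @: val F) (imset_face_neq0 f F).

Lemma push_bas (m n : nat) (f : 'I_m.+1 -> 'I_n.+1) (F : face m) :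
  push f (bas F) = bas (face_im f F).
Proof. by rewrite /push linextU -[f @: val F]/(val (face_im f F)) fcE. Qed.

Lemma push2E (m n : nat) (f : 'I_m.+1 -> 'I_n.+1) c :
  push2 f c = linext (fun p => tens (push f (bas p.1)) (push f (bas p.2))) c.
Proof. by []. Qed.

Lemma push2_linext (m n : nat) (I : finType) (f : 'I_m.+1 -> 'I_n.+1)
    (h : I -> chain2 m) c :
  push2 f (linext h c) = linext (fun x => push2 f (h x)) c.
Proof. exact: linext_comp. Qed.

Lemma push2_tens (m n : nat) (f : 'I_m.+1 -> 'I_n.+1) a b :
  push2 f (tens a b) = tens (push f a) (push f b).
Proof. exact: tmap_tens. Qed.

Lemma push2_comp (m n p : nat) (f : 'I_m.+1 -> 'I_n.+1) (g : 'I_n.+1 -> 'I_p.+1)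
    c :
  push2 g (push2 f c) = push2 (g \o f) c.
Proof.
rewrite (push2E f) push2_linext push2E; apply: eq_linext => -[F G] /=.
rewrite push2_tens !push_bas.
by congr (tens (bas _) (bas _)); apply: val_inj; exact/esym/imset_comp.
Qed.

Lemma eq_push2 (m n : nat) (f g : 'I_m.+1 -> 'I_n.+1) c :
  f =1 g -> push2 f c = push2 g c.
Proof.
move=> fg; apply: eq_linext => -[F G] /=.
rewrite !push_bas.
by congr (tens (bas _) (bas _)); apply: val_inj; apply: eq_imset.
Qed.

Lemma push2_id (n : nat) (c : chain2 n) : push2 id c = c.
Proof.
rewrite -[RHS]linext_bas push2E; apply: eq_linext => -[F G] /=.
rewrite !push_bas.
apply/ffunP => -[H K]; rewrite ffunE !basE /= -natrM mulnb xpair_eqE.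
by rewrite -!(inj_eq val_inj) /= !imset_id.
Qed.

Lemma sorted_enum_set (n : nat) (A : {set 'I_n}) : sorted ltn (map val (enum A)).
Proof.
apply: (subseq_sorted ltn_trans _ (iota_ltn_sorted 0 n)).
rewrite -val_enum_ord; apply: map_subseq; rewrite [X in subseq _ X]enumT.
exact: filter_subseq.
Qed.

Lemma steenrodE (i m n : nat) (f : 'I_m.+1 -> 'I_n.+1) (F : face n) :
    {homo f : x y / (x < y)%N} -> f @: [set: 'I_m.+1] = val F ->
  steenrod i (bas F) = push2 f (steenrod_top i m).
Proof.
move=> fh fF; have finj : injective f.
  move=> x y /(congr1 val) /= e; apply: val_inj => /=.
  by case: (ltngtP x y) => // /fh; rewrite e ltnn.
have enumF : enum (val F) = map f (enum 'I_m.+1).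
  apply: (@irr_sorted_eq _ (relpre val ltn)).
  - by move=> y x z /=; apply: ltn_trans.
  - by move=> x /=; rewrite ltnn.
  - by rewrite -sorted_map sorted_enum_set.
  - rewrite sorted_map; apply: (@sub_sorted _ (relpre val ltn)).
      by move=> x y /=; apply: fh.
    by rewrite -sorted_map val_enum_ord iota_ltn_sorted.
  - move=> x; rewrite mem_enum -fF; apply/imsetP/mapP => -[y _ ->]; exists y => //.
    by rewrite mem_enum.
have E : #|val F|.-1 = m by rewrite -fF card_imset // cardsT card_ord.
have Hv k : @vertex n F k = f (cast_ord (congr1 S E) k).
  have lt_k : (k < m.+1)%N by rewrite -[in X in (_ < X)%N]E.
  rewrite /vertex enumF (nth_map ord0) ?size_enum_ord //.
  by congr f; apply: val_inj; rewrite /= nth_enum_ord.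
rewrite /steenrod linextU; move: (@vertex n F) Hv => v Hv.
case: m / E f fh fF finj enumF Hv => f _ _ _ _ Hv.
by apply: eq_push2 => k; rewrite Hv cast_ord_id.
Qed.

(* The value on the top-dimensional face, and naturality. *)
Lemma steenrodT (i n : nat) : steenrod i (fc [set: 'I_n.+1]) = steenrod_top i n.
Proof.
have nT : [set: 'I_n.+1] != set0 by apply/set0Pn; exists ord0.
pose F : face n := Sub setT nT.
by rewrite -[setT]/(val F) fcE (@steenrodE i n n id) ?push2_id // imset_id.
Qed.

Lemma steenrod_linext (i n : nat) (I : finType) (h : I -> chain n) c :
  steenrod i (linext h c) = linext (fun x => steenrod i (h x)) c.
Proof. exact: linext_comp. Qed.

Lemma steenrod_push (i m n : nat) (f : 'I_m.+1 -> 'I_n.+1) (c : chain m) :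
    {homo f : x y / (x < y)%N} ->
  steenrod i (push f c) = push2 f (steenrod i c).
Proof.
move=> fh; rewrite /push steenrod_linext -[in RHS](linext_bas c).
rewrite [in RHS]steenrod_linext push2_linext; apply: eq_linext => F.
rewrite -[f @: val F]/(val (face_im f F)) fcE [steenrod i (bas F)]linextU.
rewrite push2_comp; apply: steenrodE => [x y xy|] /=.
  apply: fh; rewrite /vertex.
  have sF := sorted_enum_set (val F).
  have F0 : (#|val F|.-1).+1 = #|val F| by rewrite prednK // card_gt0 (valP F).
  have lt_F (z : 'I_(#|val F|.-1).+1) : (z < size (enum (val F)))%N.
    by rewrite -cardE -[X in (_ < X)%N]F0.
  rewrite -[X in (X < _)%N](nth_map _ 0%N) // -[X in (_ < X)%N](nth_map _ 0%N) //.
  by apply: (sorted_ltn_nth ltn_trans) => //; rewrite inE size_map.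
rewrite (imset_comp f (@vertex m F)).
suff -> : @vertex m F @: setT = val F by [].
apply/setP => x.
have F0 : (#|val F|.-1).+1 = #|val F| by rewrite prednK // card_gt0 (valP F).
apply/imsetP/idP => [[y _ ->]|xF].
  by rewrite -mem_enum mem_nth // -cardE -[X in (_ < X)%N]F0.
have lt_x : (index x (enum (val F)) < (#|val F|.-1).+1)%N.
  by rewrite F0 cardE index_mem mem_enum.
by exists (Ordinal lt_x); rewrite // /vertex nth_index // mem_enum.
Qed.

Lemma mem_perm_list (w : 'S_2) (x : 'I_2) : x \in perm_list w.
Proof. by apply/mapP; exists ((w^-1)%g x); rewrite ?mem_enum // permKV. Qed.

Lemma size_table_rows1 (a : 'I_2) (ws : seq 'S_2) (rs : seq nat) :
  size rs = size ws -> all (leq 1) rs -> sumn rs = size ws ->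
  size (table_rows [:: a] ws rs) = size ws.
Proof.
elim: ws rs => [|w ws IH] [|r rs] //= [sz] /andP[r0 rs0] sum_rs.
have le_rs : (size rs <= sumn rs)%N.
  elim: rs rs0 {IH sz sum_rs} => //= k rs IH /andP[k0 rs0].
  by rewrite -add1n leq_add // IH.
have r1 : r = 1%N.
  apply/eqP; rewrite eqn_leq r0 andbT -(leq_add2r (sumn rs)) sum_rs add1n ltnS.
  by rewrite -sz.
rewrite {}r1 add1n in sum_rs *; case: sum_rs => sum_rs.
case E: [seq x <- perm_list w | x \notin [:: a]] => [|x s] /=.
  have: a + 1 \in [seq x <- perm_list w | x \notin [:: a]].
    rewrite mem_filter mem_perm_list inE andbT -subr_eq0 addrC addKr.
    by rewrite oner_eq0.
  by rewrite E.
by rewrite take0 /= IH.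
Qed.

Lemma size_table_rows (ws : seq 'S_2) (rs : seq nat) :
  size rs = size ws -> all (leq 1) rs -> sumn rs = (size ws).+1 ->
  size (table_rows [::] ws rs) = (size ws).+1.
Proof.
elim: ws rs => [|w ws IH] [|r rs] //= [sz] /andP[r0 rs0] sum_rs.
have le_rs : (size rs <= sumn rs)%N.
  elim: rs rs0 {IH sz sum_rs} => //= k rs IH /andP[k0 rs0].
  by rewrite -add1n leq_add // IH.
have -> : [seq x <- perm_list w | x \notin [::]] = perm_list w.
  by rewrite (eq_filter (a2 := predT)) ?filter_predT.
have szw : size (perm_list w) = 2 by rewrite size_map size_enum_ord.
case: (perm_list w) szw => [|a [|b []]] //= _.
case: r r0 sum_rs => [|[|[|r]]] // _ sum_rs.
- by rewrite /= IH //; case: sum_rs.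
- by rewrite /= size_table_rows1 //; case: sum_rs.
move: sum_rs le_rs; rewrite !addSn sz => -[<-].
by rewrite ltnNge leq_addl.
Qed.

(* alt_be and alt_surj are basis elements, not 0. *)
Lemma alt_be_nondeg (i : nat) : nondeg (mkseq (fun k => T2 ^+ k)%g i.+1).
Proof.
apply/(sortedP 1%g) => k; rewrite size_mkseq => lt_k.
rewrite !nth_mkseq ?(ltnW lt_k) // expgSr -{1}[(T2 ^+ k)%g]mulg1.
rewrite (inj_eq (mulgI _)); apply/eqP => /permP/(_ 0).
by rewrite perm1 tpermL.
Qed.

Lemma alt_surj_nondeg (i : nat) (s : i.+2.-tuple 'I_2) :
  tval s = mkseq (fun k => if odd k then 1 else 0) i.+2 -> is_surj s.
Proof.
move=> def_s; apply/andP; split.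
  rewrite def_s; apply/(sortedP 0) => k; rewrite size_mkseq => lt_k.
  by rewrite !nth_mkseq ?(ltnW lt_k) //=; case: (odd k).
apply/forallP => a; rewrite memtE /= def_s; apply/mapP; exists (val a).
  by rewrite mem_iota /= add0n (leq_trans (ltn_ord a)).
by case: a => [[|[|]]] //= ?; apply: val_inj.
Qed.

(* Main.v *)
Require Import Defs.
From mathcomp Require Import all_boot all_order all_fingroup all_algebra.
Set Implicit Arguments.
Unset Strict Implicit.
Unset Printing Implicit Defensive.

Import GRing.Theory.
Local Open Scope ring_scope.

(* In a table (r_0, ..., r_d) with positive entries of sum d + 2, exactly one
   entry is 2, the others are 1. For an alternating sequence, a row of length 2
   that is not the last is followed by a repetition of its second value, so only
   (1, ..., 1, 2) contributes, and it gives the alternating surjection.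
   The alternating surjection acts on a face by cutting it at all weakly
   increasing sequences of i + 1 of its vertices and joining the blocks of equal
   parity. If a vertex p is repeated, the two blocks on either side of [p, p]
   have equal parity and share p, so their join vanishes; the strictly
   increasing sequences give the terms of Steenrod's formula. *)

(** * Table reduction of the alternating sequences *)

Lemma surj_class_degenerate (d : nat) (s : seq 'I_2) :
  ~~ nondeg s -> surj_class d s = 0.
Proof.
move=> ds; apply/ffunP => u; rewrite !ffunE.
have /andP[nu _] := valP u; case: eqP => //= eu; by rewrite -eu nu in ds.
Qed.

Definition alt_val (k : nat) : 'I_2 := if odd k then 1 else 0.

Lemma T2X (k : nat) : (T2 ^+ k)%g = if odd k then T2 else 1%g.
Proof.
elim: k => // k IH; rewrite expgS IH /=; case: (odd k) => //=.
  by rewrite /T2 tperm2.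
by rewrite mulg1.
Qed.

Lemma perm_list_T2X (k : nat) :
  perm_list (T2 ^+ k)%g = [:: alt_val k; alt_val k.+1].
Proof.
rewrite /perm_list enum_ordSl enum_ordSl enum_ord0 /= T2X /alt_val /=.
have -> : lift ord0 ord0 = 1 :> 'I_2 by apply: val_inj.
by case: (odd k); rewrite ?perm1 ?tpermL ?tpermR.
Qed.

Lemma alt_valS_neq (k : nat) : alt_val k.+1 != alt_val k.
Proof. by rewrite /alt_val /=; case: (odd k). Qed.

(** A row of length 1 marks no value as used, its only entry being its last. So every row reads from
    the full list, and the final row supplies the last two values. *)
Lemma table_rows_alt_nil (m d : nat) :
  table_rows [::] [seq (T2 ^+ k)%g | k <- iota m d.+1] (rcons (nseq d 1%N) 2)
    = [seq alt_val k | k <- iota m d.+2].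
Proof.
elim: d m => [|d IH] m /=; first by rewrite perm_list_T2X.
by rewrite perm_list_T2X /=; have /= -> := IH m.+1.
Qed.

Lemma size_le_sumn (rs : seq nat) :
  all (leq 1) rs -> (size rs <= sumn rs)%N.
Proof.
elim: rs => //= k rs IH /andP[k0 rs0].
by rewrite -add1n leq_add // IH.
Qed.

(** Induction on the rows; [m] is general because the remaining rows start at [T2 ^+ m.+1]. *)
Lemma table_rows_alt_nondeg (m d : nat) (rs : seq nat) :
    size rs = d.+1 -> all (leq 1) rs -> sumn rs = d.+2 ->
    nondeg (table_rows [::] [seq (T2 ^+ k)%g | k <- iota m d.+1] rs) ->
  rs = rcons (nseq d 1%N) 2.
Proof.
elim: d m rs => [|d IH] m [|r rs] //= [sz] /andP[r0 rs0] sum_rs.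
  by case: rs sz sum_rs {rs0} => //= _; rewrite addn0 => ->.
have le_rs := size_le_sumn rs0; rewrite sz in le_rs.
rewrite perm_list_T2X /=.
case: r r0 sum_rs => [|[|[|r]]] // _ sum_rs.
- rewrite /= /= => /path_sorted nd; congr cons.
  by apply: (IH m.+1) => //; case: sum_rs.
(* A first row of length 2 marks [alt_val m] as used, so the next row reduces to [alt_val m.+1], the
   value that has just ended the first row. *)
- case: rs rs0 sz sum_rs {le_rs IH} => [|r rs] //= /andP[r0 _] _ _.
  rewrite perm_list_T2X /= !inE alt_valS_neq /=.
  have -> : alt_val m.+2 = alt_val m by rewrite /alt_val /= negbK.
  rewrite eqxx /=; case: r r0 => // r _ /=; by rewrite eqxx andbF.
(* A first entry of at least 3 leaves too little for the remaining positive entries. *)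
by move: sum_rs le_rs; rewrite !addSn => -[<-]; rewrite ltnNge leq_addl.
Qed.

Definition alt_tuple (i : nat) : i.+2.-tuple 'I_2 := mktuple (fun k => alt_val k).

Lemma alt_tupleE (i : nat) :
  tval (alt_tuple i) = mkseq (fun k => if odd k then 1 else 0) i.+2.
Proof.
by rewrite /= /mkseq -val_enum_ord -map_comp; apply: eq_map.
Qed.

Definition alt_surjection (i : nat) : {s : i.+2.-tuple 'I_2 | is_surj s} :=
  exist _ (alt_tuple i) (alt_surj_nondeg (alt_tupleE i)).

Lemma alt_surjE (i : nat) : alt_surj i = bas (alt_surjection i).
Proof.
apply/ffunP => u; rewrite /alt_surj ffunE basE -alt_tupleE.
by rewrite -[u == _](inj_eq val_inj) -(inj_eq val_inj).
Qed.

Lemma table_reduction_alt (i : nat) : table_reduction (alt_be i) = alt_surj i.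
Proof.
pose w : i.+1.-tuple 'S_2 := mktuple (fun k => (T2 ^+ k)%g).
have wE : tval w = mkseq (fun k => T2 ^+ k)%g i.+1.
  by rewrite /= /mkseq -val_enum_ord -map_comp; apply: eq_map.
have nw : nondeg w by rewrite wE alt_be_nondeg.
have -> : alt_be i = bas (exist (fun w : i.+1.-tuple 'S_2 => nondeg w) w nw).
  apply/ffunP => u; rewrite /alt_be ffunE basE -wE.
  by rewrite -[u == _](inj_eq val_inj) -(inj_eq val_inj).
rewrite /table_reduction linextU /= /table_reduction1.
pose r0 := rcons_tuple (nseq_tuple i (inord 1)) (inord 2 : 'I_i.+3).
have r0E : map val r0 = rcons (nseq i 1%N) 2.
  by rewrite map_rcons map_nseq /= !inordK.
rewrite (bigD1 r0) /=; last first.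
  rewrite -(all_map val (leq 1)) r0E sumn_rcons sumn_nseq mul1n addn2 eqxx.
  by rewrite all_rcons all_nseq orbT.
rewrite big1 => [|r /andP[/andP[r_gt0 /eqP sr] nr]]; last first.
  apply: surj_class_degenerate; apply: contraNN nr => nd.
  apply/eqP; apply/val_inj/(inj_map val_inj); rewrite r0E.
  apply: (table_rows_alt_nondeg (m := 0)); rewrite ?size_map ?size_tuple //.
    by rewrite all_map.
  by rewrite wE in nd.
rewrite addr0 r0E wE table_rows_alt_nil; by [].
Qed.

(** * Cutting a vertex set into blocks *)

Definition cut (n : nat) (A : {set 'I_n.+1}) (a b : nat) : {set 'I_n.+1} :=
  [set v in A | a <= v <= b]%N.

(** Adjacent blocks both contain their common cut point when it lies in [A]. The outer bounds 0 and
    [n] need not be vertices of [A]. *)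
Definition cuts (n : nat) (A : {set 'I_n.+1}) (p : seq nat) :=
  pairmap (cut A) 0%N (rcons p n).

(* This is 0 unless t consists of m nonempty sets. *)
Definition bas_sets (n m : nat) (t : seq {set 'I_n.+1}) :
  F2free (m.-tuple (face n)) := [ffun u => (map val (tval u) == t)%:R].

Lemma bas_setsE (n m : nat) (u : m.-tuple (face n)) :
  bas_sets m (map val u) = bas u.
Proof.
apply/ffunP => v; rewrite ffunE basE -[v == u](inj_eq val_inj).
by rewrite (inj_eq (inj_map val_inj)).
Qed.

(** Turns [bas_sets] of nonempty sets into a genuine basis element, on which linear extensions can
    be evaluated. *)
Lemma face_tupleP (n m : nat) (t : seq {set 'I_n.+1}) :
    size t = m -> all (fun A => A != set0) t ->
  exists u : m.-tuple (face n), map val u = t.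
Proof.
move=> sz nt; have fT : [set: 'I_n.+1] != set0.
  by apply/set0Pn; exists ord0.
have su : size (map (insubd (exist (fun A => A != set0) _ fT : face n)) t) == m.
  by rewrite size_map sz.
exists (Tuple su) => /=; rewrite -map_comp map_id_in // => A At /=.
by rewrite insubdK //; exact: (allP nt).
Qed.

(** * Tensors and joins: vanishing, and pushforward along injections *)

Lemma tens_suml (I J K : finType) (P : pred K) (f : K -> F2free I) (b : F2free J) :
  tens (\sum_(k | P k) f k) b = \sum_(k | P k) tens (f k) b.
Proof.
apply/ffunP => x; rewrite !ffunE !sum_ffunE mulr_suml.
by apply: eq_bigr => k _; rewrite ffunE.
Qed.

Lemma tens0l (I J : finType) (b : F2free J) : tens (0 : F2free I) b = 0.
Proof. by apply/ffunP => x; rewrite !ffunE mul0r. Qed.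

Lemma tens_bas (I J : finType) (x : I) (y : J) : tens (bas x) (bas y) = bas (x, y).
Proof.
apply/ffunP => -[a b]; rewrite !ffunE !basE /= -natrM mulnb.
by rewrite xpair_eqE.
Qed.

Lemma linext0 (I : finType) (V : lmodType 'F_2) (f : I -> V) : linext f 0 = 0.
Proof. exact: linear0. Qed.

Lemma foldl_join0 (n : nat) (cs : seq (chain n)) :
  foldl (fun a b => join (tens a b)) 0 cs = 0.
Proof.
by elim: cs => //= c cs IH; rewrite tens0l [join 0]linext0.
Qed.

Lemma join_bas (n : nat) (F G : face n) :
  join (tens (bas F) (bas G)) =
    if [disjoint val F & val G] then fc (val F :|: val G) else 0.
Proof. by rewrite tens_bas /join linextU. Qed.

(** Either the first two faces meet and the join stays 0, or their union replaces them without
    losing an occurrence of [x], as at most one of them contains it. *)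
Lemma joins_shared_vertex (n : nat) (x : 'I_n.+1) (t : seq (face n)) :
  (1 < count (fun G : face n => x \in val G) t)%N -> joins [seq bas F | F <- t] = 0.
Proof.
case: t => // F t /=; elim: t F => [|G t IH] F /=; first by case: (x \in _).
rewrite join_bas; case: ifP => [dFG lt1|_ _]; last exact: foldl_join0.
have nU : val F :|: val G != set0.
  by rewrite setU_eq0 negb_and (valP F).
rewrite -[_ :|: _]/(val (exist (fun A => A != set0) _ nU : face n)) fcE.
apply: IH => /=; rewrite inE; move: lt1.
by case xF: (x \in val F) => //=; rewrite (disjointFr dFG xF).
Qed.

Lemma joins_map_fc0 (n : nat) (x : 'I_n.+1) (t : seq {set 'I_n.+1}) :
    all (fun A => A != set0) t -> (1 < count (fun A : {set _} => x \in A) t)%N ->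
  joins (map (@fc n) t) = 0.
Proof.
case/(face_tupleP erefl) => u <-; rewrite count_map -map_comp => lt1.
rewrite -(joins_shared_vertex lt1); congr joins; apply: eq_map => F.
exact: fcE.
Qed.

Lemma push_fc (m n : nat) (f : 'I_m.+1 -> 'I_n.+1) (A : {set 'I_m.+1}) :
  push f (fc A) = fc (f @: A).
Proof.
have [->|nA] := eqVneq A set0.
  rewrite imset0 /fc !insubF ?eqxx //; exact: linext0.
rewrite -[A]/(val (exist (fun A => A != set0) _ nA : face m)) fcE.
by rewrite push_bas -fcE.
Qed.

Lemma disjoint_imset_inj (S T : finType) (f : S -> T) (A B : {set S}) :
  injective f -> [disjoint f @: A & f @: B] = [disjoint A & B].
Proof. by move=> fi; rewrite -!setI_eq0 -imsetI ?imset_eq0 // => x y _ _ /fi. Qed.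

Lemma push_join (m n : nat) (f : 'I_m.+1 -> 'I_n.+1) (c : chain2 m) :
  injective f -> push f (join c) = join (push2 f c).
Proof.
move=> fi; rewrite [LHS]linext_comp [RHS]linext_comp; apply: eq_linext => -[F G] /=.
rewrite !push_bas -/(join _) join_bas -/(push f _) disjoint_imset_inj //=.
case: ifP => _; last exact: linext0.
by rewrite push_fc imsetU.
Qed.

Lemma push_joins (m n : nat) (f : 'I_m.+1 -> 'I_n.+1) (cs : seq (chain m)) :
  injective f -> push f (joins cs) = joins (map (push f) cs).
Proof.
move=> fi; case: cs => [|c cs]; first exact: linext0.
rewrite /joins [map _ _]/=.
elim: cs c => [//|b cs IH] c.
rewrite [map _ _]/= [foldl _ _ (b :: cs)]/= [foldl _ _ (_ :: map _ _)]/=.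
by rewrite IH (push_join _ fi) push2_tens.
Qed.

(** * The iterated Alexander-Whitney diagonal of a face *)

Lemma iterAW_linext (n m : nat) (c : chain n) :
  iterAW m c = linext (fun F => iterAW m (bas F)) c.
Proof.
case: m => [|m] /=; first by apply: eq_linext => F; rewrite linextU.
rewrite /AW /tmap !linext_comp; apply: eq_linext => F.
by rewrite linextU ?linext_comp.
Qed.

(** Used when the front face at a split vertex [b] is cut again: cut points up to [b] give the same
    inner blocks, and the last block, formally running to [n], stops at [b]. *)
Lemma cut_below (n : nat) (A : {set 'I_n.+1}) (a b : nat) (q : seq nat) :
    all (leq^~ b) q -> (b <= n)%N ->
  pairmap (cut [set v in A | v <= b]%N) a (rcons q n) = pairmap (cut A) a (rcons q b).
Proof.
move=> qb bn; elim: q a qb => [|c q IH] a /=; last first.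
  case/andP => cb qb; rewrite IH //; congr cons.
  apply/setP => v; rewrite !inE; case: (leqP v c) => vc; rewrite ?andbF //.
  by rewrite (leq_trans vc cb) !andbT.
move=> _; congr cons; apply/setP => v; rewrite !inE.
by rewrite leq_ord andbT -andbA [X in _ && X]andbC.
Qed.

(** The first block contains [x], and each later block contains the cut point at which it starts. *)
Lemma cuts_neq0 (n : nat) (A : {set 'I_n.+1}) (a : nat) (x : 'I_n.+1)
    (p : seq 'I_n.+1) :
    x \in A -> (a <= x)%N -> path leq x (map val p) -> {subset p <= A} ->
  all (fun B => B != set0) (pairmap (cut A) a (rcons (map val p) n)).
Proof.
elim: p a x => [|b p IH] a x xA ax /=.
  by move=> _ _; rewrite andbT; apply/set0Pn; exists x; rewrite !inE xA ax leq_ord.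
case/andP=> xb pb pA; apply/andP; split.
  by apply/set0Pn; exists x; rewrite !inE xA ax.
apply: (IH b b) => //; first by apply: pA; rewrite mem_head.
by move=> y yp; apply: pA; rewrite inE yp orbT.
Qed.

Lemma cuts_sorted_neq0 (n : nat) (A : {set 'I_n.+1}) (p : seq 'I_n.+1) :
    A != set0 -> sorted leq (map val p) -> {subset p <= A} ->
  all (fun B => B != set0) (cuts A (map val p)).
Proof.
case: p => [|b p] /set0Pn[x xA] /= pp pA; first exact: (@cuts_neq0 _ A 0 x [::]).
apply: (@cuts_neq0 _ A 0 b (b :: p)) => //=; last by rewrite leqnn.
by apply: pA; rewrite mem_head.
Qed.

(** The recursion of [iterAW] splits off the last tensor factor, so the last cut point has to become
    the outer summation index. *)
Lemma big_rcons_tuple (R : Type) (idx : R) (op : Monoid.com_law idx)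
    (T : finType) (m : nat) (P : pred (m.+1.-tuple T)) (X : m.+1.-tuple T -> R) :
  \big[op/idx]_(p | P p) X p =
  \big[op/idx]_(j : T) \big[op/idx]_(q : m.-tuple T | P (rcons_tuple q j))
    X (rcons_tuple q j).
Proof.
rewrite pair_big_dep /=.
rewrite (reindex (fun r : T * m.-tuple T => rcons_tuple r.2 r.1)).
  by apply: eq_bigl => -[j q].
exists (fun t => (last (thead t) (behead t), belast_tuple (thead t) (behead_tuple t))).
  move=> [j q] _ /=; have := congr1 val (tuple_eta (rcons_tuple q j)).
  rewrite [X in _ = X]lastI => /rcons_inj[eq ej].
  by congr pair; [rewrite [RHS]ej | apply: val_inj; rewrite /= [RHS]eq].
move=> t _; apply: val_inj; rewrite /= -lastI; exact: esym (congr1 val (tuple_eta t)).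
Qed.

(** Induction on the number of cuts: the outer diagonal splits at the last cut vertex [j], and the
    earlier cuts subdivide the front face. Their vertices are thus at most [j], which makes the
    whole tuple weakly increasing. *)
Lemma iterAW_bas (n m : nat) (F : face n) :
  iterAW m (bas F) =
    \sum_(p : m.-tuple 'I_n.+1 | sorted leq (map val p) && all (mem (val F)) p)
       bas_sets m.+1 (cuts (val F) (map val p)).
Proof.
elim: m F => [|m IH] F.
  rewrite /= linextU.
  rewrite (big_pred1 [tuple]) => [|p]; last by rewrite tuple0 /= eqxx.
  rewrite -(bas_setsE [tuple F]); congr (bas_sets _ _).
  rewrite /cuts /=; congr [:: _]; apply/setP => v.
  by rewrite !inE leq_ord /= !andbT. 
rewrite big_rcons_tuple /= /AW linextU.
rewrite [tmap _ _ _]linear_sum linear_sum big_mkcond /=.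
apply: eq_bigr => j _.
case: ifP => jF; last first.
  rewrite big_pred0 // => q; by rewrite all_rcons /= jF andbF.
have n1 : [set v in val F | v <= j]%N != set0.
  by apply/set0Pn; exists j; rewrite inE jF leqnn.
have n2 : [set v in val F | j <= v]%N != set0.
  by apply/set0Pn; exists j; rewrite inE jF leqnn.
rewrite -[[set v in val F | v <= j]%N]/(val (exist (fun A => A != set0) _ n1 : face n)) fcE.
rewrite -[[set v in val F | j <= v]%N]/(val (exist (fun A => A != set0) _ n2 : face n)) fcE.
rewrite tens_bas linextU /= IH tens_suml linear_sum /=.
have allE (q : seq 'I_n.+1) : all (mem [set v in val F | v <= j]%N) q =
    all (mem (val F)) q && all (leq^~ j) (map val q).
  by rewrite all_map -all_predI; apply: eq_all => x; rewrite /= inE.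
apply: eq_big => [q|q].
  rewrite map_rcons !(sorted_pairwise leq_trans) pairwise_rcons all_rcons /= jF /=.
  by rewrite allE [LHS]andbA [LHS]andbC [LHS]andbA.
rewrite allE => /and3P[sq qF qj].
have sz : size (cuts [set v in val F | v <= j]%N (map val q)) = m.+1.
  by rewrite size_pairmap size_rcons size_map size_tuple.
have nz : all (fun A => A != set0) (cuts [set v in val F | v <= j]%N (map val q)).
  apply: cuts_sorted_neq0 => //; apply/allP; by rewrite allE qF.
have [u uE] := face_tupleP sz nz.
rewrite -{1}uE bas_setsE tens_bas linextU /= -bas_setsE /= map_rcons uE.
congr bas_sets; rewrite /cuts map_rcons cut_below ?leq_ord //.
(* The last block, from [j] to [n], is the back face at [j]. *)
rewrite -[rcons (rcons _ _) n]cats1 pairmap_cat last_rcons -cats1; congr (_ ++ [:: _]).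
by apply/setP => v; rewrite !inE leq_ord andbT.
Qed.

(** * The action of the alternating surjection *)

Lemma mask_iota (T : Type) (x0 : T) (P : pred nat) (t : seq T) :
  mask [seq P k | k <- iota 0 (size t)] t
    = [seq nth x0 t k | k <- iota 0 (size t) & P k].
Proof. by rewrite filter_mask map_mask -/(mkseq (nth x0 t) _) mkseq_nth. Qed.

(** Common form of both sides: the fibers of the alternating surjection and the two factors in
    Steenrod's formula select blocks by the parity of their position. *)
Definition parity_join (n : nat) (b : bool) (cs : seq (chain n)) : chain n :=
  joins (mask [seq odd k == b | k <- iota 0 (size cs)] cs).

Definition parity_tens (n : nat) (cs : seq (chain n)) : chain2 n :=
  tens (parity_join false cs) (parity_join true cs).

Lemma fiber_join_alt (i n : nat) (b : bool) (u : i.+2.-tuple (face n)) :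
  fiber_join (alt_tuple i) (if b then 1 else 0) u =
    parity_join b [seq fc A | A <- map val u].
Proof.
rewrite /fiber_join /parity_join map_mask alt_tupleE -!map_comp size_map size_tuple.
congr (joins (mask _ _)); last by apply: eq_map => F /=; rewrite fcE.
by apply: eq_map => k /=; case: b; case: (odd k).
Qed.

Lemma surj_act1_alt (i n : nat) (F : face n) :
  surj_act1 (alt_tuple i) (bas F) =
    \sum_(p : i.+1.-tuple 'I_n.+1 | sorted leq (map val p) && all (mem (val F)) p)
       parity_tens [seq fc A | A <- cuts (val F) (map val p)].
Proof.
rewrite /surj_act1 iterAW_bas linear_sum /=; apply: eq_bigr => p /andP[sp /allP pF].
have nz := cuts_sorted_neq0 (valP F) sp pF.
have sz : size (cuts (val F) (map val p)) = i.+2.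
  by rewrite size_pairmap size_rcons size_map size_tuple.
have [u <-] := face_tupleP sz nz.
rewrite bas_setsE linextU /parity_tens.
by rewrite -!fiber_join_alt.
Qed.

(** * Vanishing of the terms with a repeated cut point *)

Lemma parity_join_shared (n : nat) (x : 'I_n.+1) (t : seq {set 'I_n.+1}) (k : nat) :
    all (fun A => A != set0) t -> (k.+2 < size t)%N ->
    x \in nth set0 t k -> x \in nth set0 t k.+2 ->
  parity_join (odd k) (map (@fc n) t) = 0.
Proof.
move=> nz lt_k xk xk2; rewrite /parity_join size_map -map_mask.
apply: (joins_map_fc0 (x := x)); first exact: all_mask.
rewrite (mask_iota set0) count_map -size_filter -filter_predI.
(* The distinct positions [k] and [k.+2] have equal parity and both carry [x]. *)
apply: (@uniq_leq_size _ [:: k; k.+2]).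
  by rewrite /= inE andbT -[X in X == _]addn0 -addn2 eqn_add2l.
move=> l; rewrite !inE mem_filter mem_iota /= => /orP[]/eqP->.
  by rewrite xk eqxx (ltn_trans _ lt_k).
by rewrite xk2 /= negbK eqxx.
Qed.

Lemma parity_tens_shared (n : nat) (x : 'I_n.+1) (t : seq {set 'I_n.+1}) (k : nat) :
    all (fun A => A != set0) t -> (k.+2 < size t)%N ->
    x \in nth set0 t k -> x \in nth set0 t k.+2 ->
  parity_tens (map (@fc n) t) = 0.
Proof.
move=> nz lt_k xk xk2; have := parity_join_shared nz lt_k xk xk2.
rewrite /parity_tens; case: (odd k) => ->; last exact: tens0l.
by apply/ffunP => y; rewrite !ffunE mulr0.
Qed.

Lemma parity_tens_degenerate (n : nat) (A : {set 'I_n.+1}) (p : seq 'I_n.+1) :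
    A != set0 -> sorted leq (map val p) -> {subset p <= A} ->
    ~~ sorted ltn (map val p) ->
  parity_tens [seq fc B | B <- cuts A (map val p)] = 0.
Proof.
move=> nA sp pA; apply: contraNeq => nz; apply/(sortedP 0%N) => k lt_k.
have le_k := sortedP 0%N sp _ lt_k.
suff: (nth 0%N (map val p) k < nth 0%N (map val p) k.+1)%N by [].
rewrite ltn_neqAle le_k andbT; apply: contraNneq nz => eq_k; apply/eqP.
rewrite size_map in lt_k.
have lt_k' := ltnW lt_k.
pose x := nth ord0 p k.
have xE : val x = nth 0%N (map val p) k by rewrite (nth_map ord0).
have xA : x \in A by apply: pA; apply: mem_nth.
(* Block [k] ends at cut point [k], and block [k.+2] starts at cut point [k.+1], which is the same
   vertex [x]. *)
apply: (parity_tens_shared (x := x) (k := k)).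
- exact: cuts_sorted_neq0.
- by rewrite size_pairmap size_rcons size_map.
- rewrite (nth_pairmap 0%N) ?size_rcons ?size_map ?(ltnW lt_k') // 1?ltnW //.
  rewrite nth_rcons size_map lt_k' -xE inE xA leqnn /=.
  rewrite andbT xE; case: (k) lt_k' => [|l] //= lt_l.
  rewrite nth_rcons size_map (ltnW lt_l).
  by apply: (sortedP 0%N sp); rewrite size_map.
rewrite (nth_pairmap 0%N) ?size_rcons ?size_map //=.
rewrite !nth_rcons size_map lt_k -eq_k -xE inE xA leqnn /=.
(* The right end of block [k.+2] is the next cut point, or [n] for the last block. *)
case: ltngtP => [lt_k2||_]; last by rewrite leq_ord.
  2: by rewrite ltnS leqNgt lt_k.
by rewrite xE eq_k; apply: (sortedP 0%N sp); rewrite size_map.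
Qed.

(** * Comparison with Steenrod's formula *)

Lemma push_parity_tens (m n : nat) (f : 'I_m.+1 -> 'I_n.+1) (cs : seq (chain m)) :
  injective f -> push2 f (parity_tens cs) = parity_tens (map (push f) cs).
Proof.
move=> fi; rewrite push2_tens /parity_tens /parity_join size_map.
by rewrite !push_joins // !map_mask.
Qed.

(** Only the inequalities imposed by the bounds have to correspond: 0 and [n] need not be the images
    of 0 and [m] under [f]. *)
Lemma push_interval (m n : nat) (f : 'I_m.+1 -> 'I_n.+1) (a a' b b' : nat) :
    (forall v : 'I_m.+1, (a <= v)%N = (a' <= f v)%N) ->
    (forall v : 'I_m.+1, (v <= b)%N = (f v <= b')%N) ->
  push f (Defs.interval m a b) = fc (cut (f @: [set: 'I_m.+1]) a' b').
Proof.
move=> aE bE; rewrite push_fc; congr fc; apply/setP => x; rewrite !inE.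
apply/imsetP/andP => [[v]|[/imsetP[v _ ->] ab]].
  by rewrite inE aE bE => ? ->; rewrite imset_f ?inE.
by exists v; rewrite // inE aE bE.
Qed.

Lemma homo_ltn_leq (m n : nat) (f : 'I_m.+1 -> 'I_n.+1) :
    {homo f : x y / (x < y)%N} ->
  forall x y, (f x <= f y)%N = (x <= y)%N.
Proof.
move=> fh x y; case: (ltngtP x y) => [/fh/ltnW|/fh|/val_inj->] //.
  by rewrite ltnNge => /negbTE.
exact: leqnn.
Qed.

Lemma push_blocks (m n : nat) (f : 'I_m.+1 -> 'I_n.+1) (a a' : nat)
    (p : seq 'I_m.+1) :
    {homo f : x y / (x < y)%N} ->
    (forall v : 'I_m.+1, (a <= v)%N = (a' <= f v)%N) ->
  map (push f) (pairmap (Defs.interval m) a (rcons (map val p) m)) =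
    [seq fc A | A <- pairmap (cut (f @: [set: 'I_m.+1])) a'
                       (rcons (map val (map f p)) n)].
Proof.
move=> fh; elim: p a a' => [|b p IH] a a' aE /=.
  by rewrite (push_interval aE (b' := n)) // => v; rewrite !leq_ord.
congr cons; first by apply: push_interval => // v; rewrite homo_ltn_leq.
by apply: IH => v; rewrite homo_ltn_leq.
Qed.

(** For [m < i] the right side is an empty sum, since [i.+1] distinct entries do not fit among
    [m.+1] vertices. *)
Lemma steenrod_topE (i m : nat) :
  steenrod_top i m = \sum_(p : i.+1.-tuple 'I_m.+1 | sorted ltn (map val p))
    parity_tens (steenrod_blocks m (map val p)).
Proof.
rewrite /steenrod_top; case: ltnP => [lt_mi|_].
  rewrite big_pred0 // => p; apply/negbTE/negP => sp.
  have up : uniq p by apply: map_uniq (sorted_uniq ltn_trans ltnn sp).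
  have := max_card (mem p); rewrite (card_uniqP up) size_tuple card_ord.
  by rewrite ltnS leqNgt lt_mi.
apply: eq_bigr => p _; rewrite /parity_tens /parity_join !(mask_iota 0).
by congr tens; congr joins; congr map; apply: eq_filter => k; case: odd.
Qed.

(** Hides the dimension [#|val F|.-1] behind a variable [m], as [steenrodE] expects. *)
Lemma face_parametrization (n : nat) (F : face n) :
  exists m (f : 'I_m.+1 -> 'I_n.+1),
    {homo f : x y / (x < y)%N} /\ f @: [set: 'I_m.+1] = val F.
Proof.
exists #|val F|.-1, (@vertex n F).
have F0 : (#|val F|.-1).+1 = size (enum (val F)).
  by rewrite -cardE prednK // card_gt0 (valP F).
split=> [x y xy|].
  have tr : transitive (relpre val ltn : rel 'I_n.+1).
    by move=> ? ? ? /=; apply: ltn_trans.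
  have sF := sorted_enum_set (val F); rewrite sorted_map in sF.
  by apply: (sorted_ltn_nth tr ord0 sF) => //; rewrite inE -F0.
apply/setP => x; apply/imsetP/idP => [[y _ ->]|xF].
  by rewrite -mem_enum mem_nth // -F0.
have lt_x : (index x (enum (val F)) < (#|val F|.-1).+1)%N.
  by rewrite F0 index_mem mem_enum.
by exists (Ordinal lt_x); rewrite // /vertex nth_index // mem_enum.
Qed.

(** After the degenerate cuts are discarded, the strictly increasing tuples in [F] correspond under
    [f] to those in the standard [m]-simplex, term by term. *)
Lemma surj_act1_alt_bas (i n : nat) (F : face n) :
  surj_act1 (alt_tuple i) (bas F) = steenrod i (bas F).
Proof.
have [m [f [fh fF]]] := face_parametrization F.
have fle := homo_ltn_leq fh.
have fi : injective f.
  by move=> x y e; apply/val_inj/eqP; rewrite eqn_leq -!fle e !leqnn.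
rewrite (steenrodE i fh fF) steenrod_topE [RHS]linear_sum surj_act1_alt /=.
rewrite (bigID (fun p : i.+1.-tuple _ => sorted ltn (map val p))) /=.
rewrite [X in _ + X]big1 => [|p /andP[/andP[sp /allP pF]]]; last first.
  exact: parity_tens_degenerate (valP F) sp pF.
rewrite addr0.
(* A left inverse of [f], inverse to it on the vertices of [F], for reindexing the tuples. *)
pose g x := odflt ord0 [pick k | f k == x].
have gK : cancel f g.
  move=> k; rewrite /g; case: pickP => [l /eqP/fi //|/(_ k)].
  by rewrite eqxx.
have fK x : x \in val F -> f (g x) = x.
  by rewrite -fF => /imsetP[k _ ->]; rewrite gK.
rewrite (reindex_onto (map_tuple f) (map_tuple g)) => [|p /andP[/andP[_ /allP pF] _]].
  apply: eq_big => [p|p _]; last first.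
    rewrite -[linext _ _]/(push2 f _) push_parity_tens // (push_blocks p fh (a' := 0)) //.
    by rewrite fF.
  have -> : (map_tuple g (map_tuple f p) == p).
    by apply/eqP; apply: val_inj; rewrite /= -map_comp map_id_in // => x _; exact: gK.
  rewrite andbT -fF.
  have -> : all (mem (f @: [set: 'I_m.+1])) (map f p).
    by apply/allP => _ /mapP[k _ ->]; apply: imset_f; rewrite inE.
  rewrite andbT -map_comp.
  apply/andP/idP => [[_]|sp].
    by rewrite !sorted_map; apply: sub_sorted => x y /=; rewrite !ltnNge fle.
  rewrite sorted_map in sp.
  have spf : sorted (relpre (fun x => val (f x)) ltn) p.
    by apply: sub_sorted sp => x y /=; apply: fh.
  by rewrite !sorted_map; split=> //; apply: sub_sorted spf => x y; apply: ltnW.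
apply: val_inj; rewrite /= -map_comp map_id_in // => x /pF; exact: fK.
Qed.

Theorem mainTheorem6 (i : nat) :
  table_reduction (alt_be i) = alt_surj i
  /\ (forall (n : nat) (c : chain n), be_act (alt_be i) c = steenrod i c).
Proof.
split=> [|n c]; first exact: table_reduction_alt.
rewrite /be_act table_reduction_alt alt_surjE /surj_act linextU.
rewrite -[c in RHS]linext_bas steenrod_linext.
(* Both sides are now linear extensions in [c], so comparing them on one face suffices. *)
rewrite /surj_act1 iterAW_linext linext_comp; apply: eq_linext => F.
exact: surj_act1_alt_bas.
Qed.
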